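(* Let $K$ be a field of characteristic zero. Then $$\mathbb{I}_1=\bigoplus_{i,j\ge0}Kx^i\partial^j\ \oplus\ \bigoplus_{k,l\ge0}Ke_{kl}\ \oplus\ \bigoplus\Big\{K\textstyle\int^sH^t\ \Big|\ s\ge1,\ t=0,1,\ldots,s-1\Big\},$$ i.e. the set $\{x^i\partial^j,\ e_{kl},\ \int^sH^t\mid i,j,k,l\ge0;\ s\ge1;\ t=0,1,\ldots,s-1\}$ is a $K$-basis of the algebra $\mathbb{I}_1$. Moreover, for every $n\ge1$ the $n$-th tensor product of this basis is a $K$-basis of the algebra $\mathbb{I}_n=\mathbb{I}_1^{\otimes n}$; that is, the products $b_1b_2\cdots b_n$, where for each $i$ the element $b_i$ runs over the basis $\{x_i^p\partial_i^q,\ e_{kl}(i),\ \int_i^sH_i^t\mid p,q,k,l\ge0;\ s\ge1;\ t=0,1,\ldots,s-1\}$ of the $i$-th tensor factor $\mathbb{I}_1(i)$, with $H_i:=\partial_ix_i$ and $e_{kl}(i):=\int_i^k\partial_i^l-\int_i^{k+1}\partial_i^{l+1}$, form a $K$-basis of $\mathbb{I}_n$.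
   Context: $\mathbb{I}_n=K\langle x_1,\ldots,x_n,\partial_1,\ldots,\partial_n,\int_1,\ldots,\int_n\rangle$ is the subalgebra of $\mathrm{End}_K(K[x_1,\ldots,x_n])$ generated by the multiplications by $x_i$, the partial derivatives $\partial_i=\partial/\partial x_i$ and the integrations $\int_i$, i.e. the $K$-linear maps $x_1^{\alpha_1}\cdots x_n^{\alpha_n}\mapsto(\alpha_i+1)^{-1}x_i\,x_1^{\alpha_1}\cdots x_n^{\alpha_n}$. One has $\mathbb{I}_n=\bigotimes_{i=1}^n\mathbb{I}_1(i)$ with $\mathbb{I}_1(i)=K\langle x_i,\partial_i,\int_i\rangle\simeq\mathbb{I}_1$. For $n=1$ the index is dropped: $x,\partial,\int$; $H:=\partial x\in\mathbb{I}_1$ and $e_{kl}:=\int^k\partial^l-\int^{k+1}\partial^{l+1}$ for $k,l\ge0$. *)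

(* Defs.v *)
(* boolp is used to equip the type of linear endomorphisms of an arbitrary module
   with the choiceType structure and the extensional equality that a ring needs. *)
From HB Require Import structures.
From mathcomp Require Import all_boot all_order all_algebra.
From mathcomp Require Import boolp.
From mathcomp Require Import ssrcomplements mpoly.

Set Implicit Arguments.
Unset Strict Implicit.
Unset Printing Implicit Defensive.

Import GRing.Theory.
Local Open Scope ring_scope.

(* The algebra End_R(V) of all R-linear endomorphisms of V, which MathComp only
   has for finite-dimensional V.  The product is composition: (f * g) v = f (g v).
   The multiplication of V plays no role: V is an lalgType only because algType
   requires 1 <> 0, hence V <> 0. *)
Section LinearEndomorphisms.
Context (R : comNzRingType) (V : lalgType R).

Definition lend : Type := {linear V -> V}.
Definition lend_fun (f : lend) : V -> V := GRing.Linear.sort f.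
Coercion lend_fun : lend >-> Funclass.

HB.instance Definition _ := gen_eqMixin lend.
HB.instance Definition _ := gen_choiceMixin lend.

Lemma lendP (f g : lend) : (forall v, f v = g v) -> f = g.
Proof.
case: f g => [f cf] [g cg] /= /funext efg.
rewrite /lend_fun /= in efg; case: _ / efg cg => cg.
congr GRing.Linear.Pack.
case: cf cg => [[a0] [a1]] [[b0] [b1]].
by rewrite (Prop_irrelevance a0 b0) (Prop_irrelevance a1 b1).
Qed.

Definition lend0 : lend := (\0 : V -> V)%R : {linear V -> V}.
Definition lend_opp (f : lend) : lend :=
  (\- (f : {linear V -> V}))%R : {linear V -> V}.
Definition lend_add (f g : lend) : lend :=
  ((f : {linear V -> V}) \+ (g : {linear V -> V}))%R : {linear V -> V}.
Definition lend1 : lend := (@idfun V : {linear V -> V}).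
Definition lend_mul (f g : lend) : lend :=
  ((f : {linear V -> V}) \o (g : {linear V -> V})) : {linear V -> V}.
Definition lend_scale (a : R) (f : lend) : lend :=
  (a \*: (f : {linear V -> V}))%R : {linear V -> V}.

Fact lend_addA : associative lend_add.
Proof. by move=> f g h; apply: lendP => v; apply: addrA. Qed.
Fact lend_addC : commutative lend_add.
Proof. by move=> f g; apply: lendP => v; apply: addrC. Qed.
Fact lend_add0 : left_id lend0 lend_add.
Proof. by move=> f; apply: lendP => v; apply: add0r. Qed.
Fact lend_addN : left_inverse lend0 lend_opp lend_add.
Proof. by move=> f; apply: lendP => v; apply: addNr. Qed.
HB.instance Definition _ :=
  GRing.isZmodule.Build lend lend_addA lend_addC lend_add0 lend_addN.

Fact lend_mulA : associative lend_mul.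
Proof. by move=> f g h; apply: lendP. Qed.
Fact lend_mul1l : left_id lend1 lend_mul.
Proof. by move=> f; apply: lendP. Qed.
Fact lend_mul1r : right_id lend1 lend_mul.
Proof. by move=> f; apply: lendP. Qed.
Fact lend_mulDl : left_distributive lend_mul +%R.
Proof. by move=> f g h; apply: lendP. Qed.
Fact lend_mulDr : right_distributive lend_mul +%R.
Proof. by move=> f g h; apply: lendP => v; apply: linearD. Qed.
HB.instance Definition _ := GRing.Zmodule_isPzRing.Build lend
  lend_mulA lend_mul1l lend_mul1r lend_mulDl lend_mulDr.

Fact lend_1neq0 : 1 != 0 :> lend.
Proof.
apply/eqP => /(congr1 (fun f : lend => f 1)) /eqP.
by rewrite [_ == _](oner_eq0 V).
Qed.
HB.instance Definition _ := GRing.PzSemiRing_isNonZero.Build lend lend_1neq0.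

Fact lend_scaleA a b f : lend_scale a (lend_scale b f) = lend_scale (a * b) f.
Proof. by apply: lendP => v; apply: scalerA. Qed.
Fact lend_scale1 : left_id 1 lend_scale.
Proof. by move=> f; apply: lendP => v; apply: scale1r. Qed.
Fact lend_scaleDr : right_distributive lend_scale +%R.
Proof. by move=> a f g; apply: lendP => v; apply: scalerDr. Qed.
Fact lend_scaleDl f : {morph lend_scale^~ f : a b / a + b}.
Proof. by move=> a b; apply: lendP => v; apply: scalerDl. Qed.
HB.instance Definition _ := GRing.Zmodule_isLmodule.Build R lend
  lend_scaleA lend_scale1 lend_scaleDr lend_scaleDl.

Fact lend_scaleAl (a : R) (f g : lend) : a *: (f * g) = (a *: f) * g.
Proof. exact: lendP. Qed.
HB.instance Definition _ :=
  GRing.LSemiModule_isLSemiAlgebra.Build R lend lend_scaleAl.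

Fact lend_scaleAr (a : R) (f g : lend) : a *: (f * g) = f * (a *: g).
Proof. by apply: lendP => v; symmetry; apply: linearZ. Qed.
HB.instance Definition _ :=
  GRing.LSemiAlgebra_isSemiAlgebra.Build R lend lend_scaleAr.

End LinearEndomorphisms.

Section AlgebrasAndBases.
Context (K : fieldType).

Definition gen_subalg (A : algType K) (G : A -> Prop) (a : A) : Prop :=
  forall S : {pred A},
    GRing.subalg_closed S -> (forall g, G g -> g \in S) -> a \in S.

(* Bases and internal direct sum decompositions of the subspace of V with
   membership predicate P, which may be infinite-dimensional. *)
Definition is_basis (V : lmodType K) (J : eqType) (P : V -> Prop)
    (b : J -> V) : Prop :=
  [/\ forall j, P (b j),
      forall (s : seq J) (c : J -> K), uniq s ->
        \sum_(j <- s) c j *: b j = 0 -> forall j, j \in s -> c j = 0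
    & forall v, P v ->
        exists (s : seq J) (c : J -> K), v = \sum_(j <- s) c j *: b j].

Definition is_direct_sum (V : lmodType K) (J : eqType) (P : V -> Prop)
    (W : J -> V -> Prop) : Prop :=
  [/\ forall j w, W j w -> P w,
      forall (s : seq J) (w : J -> V), uniq s -> (forall j, W j (w j)) ->
        \sum_(j <- s) w j = 0 -> forall j, j \in s -> w j = 0
    & forall v, P v ->
        exists (s : seq J) (w : J -> V),
          (forall j, W j (w j)) /\ v = \sum_(j <- s) w j].

Definition line (V : lmodType K) (v w : V) : Prop := exists c : K, w = c *: v.

End AlgebrasAndBases.

Section IntegroDifferentialOperators.
Context (K : fieldType) (n : nat).
Local Notation P := {mpoly K[n]}.
Implicit Types (i : 'I_n) (p : P).

Definition mint i p : P :=
  \sum_(m <- msupp p) p@_m *: ((m i).+1%:R^-1 *: ('X_i * 'X_[m])).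

Fact mint_is_linear i : linear (mint i).
Proof.
have mintwE k (q : P) : (msize q <= k)%N -> mint i q =
    \sum_(m : 'X_{1..n < k}) q@_m *: ((m i).+1%:R^-1 *: ('X_i * 'X_[m])).
  pose I : subFinType _ := 'X_{1..n < k}.
  move=> le_qk; rewrite /mint (big_mksub I) /=; first last.
  - by move=> x /msize_mdeg_lt/leq_trans/(_ le_qk).
  - by rewrite msupp_uniq.
  rewrite big_rmcond //= => j /memN_msupp_eq0 ->.
  by rewrite scale0r.
move=> c p q.
pose k := (msize p + msize q + msize (c *: p + q))%N.
rewrite !(mintwE k) ?leq_addl // /k; first last.
- by rewrite -addnA leq_addr.
- by rewrite addnAC leq_addl.
rewrite scaler_sumr -big_split /=; apply/eq_bigr => m _.
by rewrite mcoeffD mcoeffZ scalerDl !scalerA.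
Qed.
HB.instance Definition _ i := GRing.isLinear.Build K P P *:%R (mint i)
  (mint_is_linear i).

Lemma mintX i (m : 'X_{1..n}) :
  mint i 'X_[m] = (m i).+1%:R^-1 *: ('X_i * 'X_[m]).
Proof. by rewrite /mint msuppX big_seq1 mcoeffX eqxx scale1r. Qed.

Fact mulX_is_linear i : linear (fun p : P => 'X_i * p).
Proof. by move=> c p q; rewrite mulrDr scalerAr. Qed.
Definition mulX i p : P := 'X_i * p.
HB.instance Definition _ i := GRing.isLinear.Build K P P *:%R (mulX i)
  (mulX_is_linear i).

Definition op_x i : lend P := mulX i : {linear P -> P}.
Definition op_d i : lend P := mderiv i : {linear P -> P}.
Definition op_int i : lend P := mint i : {linear P -> P}.

Definition op_H i : lend P := op_d i * op_x i.
Definition op_e i (k l : nat) : lend P :=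
  op_int i ^+ k * op_d i ^+ l - op_int i ^+ k.+1 * op_d i ^+ l.+1.

(* The algebra I_n; alg_I for n = 1 is I_1. *)
Definition alg_I : lend P -> Prop :=
  gen_subalg (fun f => exists i, [\/ f = op_x i, f = op_d i | f = op_int i]).

(* The tensor factor I_1(i), realised inside I_n. *)
Definition alg_I1 i : lend P -> Prop :=
  gen_subalg (fun f => [\/ f = op_x i, f = op_d i | f = op_int i]).

End IntegroDifferentialOperators.

(* Indices (p, q) of x^p d^q, (k, l) of e_kl, and (s, t) of int^s H^t; the
   constraint t < s in the last summand subsumes s >= 1. *)
Definition I1_index : Type :=
  (nat * nat) + (nat * nat) + {st : nat * nat | (st.2 < st.1)%N}.
HB.instance Definition _ := Choice.on I1_index.

Definition I1_basis (K : fieldType) (n : nat) (i : 'I_n) (j : I1_index) :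
    lend {mpoly K[n]} :=
  match j with
  | inl (inl (p, q)) => op_x K i ^+ p * op_d K i ^+ q
  | inl (inr (k, l)) => op_e K i k l
  | inr st => op_int K i ^+ (val st).1 * op_H K i ^+ (val st).2
  end.

(* Main.v *)
Require Import Defs.
From mathcomp Require Import all_boot all_order all_algebra.
From mathcomp Require Import boolp mpoly zify.

Set Implicit Arguments.
Unset Strict Implicit.
Unset Printing Implicit Defensive.

Import GRing.Theory.
Local Open Scope ring_scope.

(** Write y for the integration and H = d x.

    Spanning.  The operators satisfy d y = 1, d x = x d + 1 and y d x = x.  These
    relations alone show that the span of the proposed basis is stable under left
    multiplication by x, d and y ([span_normal_form_mul]); since it contains 1, it
    contains the whole algebra ([gen_subalg_span]).  The two cases with content
    are y x^p d^q, treated by integration by parts ([span_y_xd]), and y^s H^s,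
    which equals x^s modulo the y^s H^t with t < s ([xX_low]).  In several
    variables, a generator of the i-th factor commutes with the other factors,
    which reduces the claim to one variable ([span_tensor_mul]).

    Independence.  Each basis element acts on the divided powers x^m/m! as a
    weighted shift ([acts_I1_basis]), so it is a matrix supported on one diagonal.
    Far down a diagonal, the entries of x^p d^q and y^s H^t are polynomials in the
    row number, of pairwise distinct degrees p and t ([degree_inj]), whereas e_kl
    is a matrix unit and does not contribute.  In characteristic 0 a polynomial
    with infinitely many natural roots is 0, so first the coefficients of all
    x^p d^q and y^s H^t vanish, then those of the e_kl ([entry_indep]).  In several
    variables the entries are products of one-variable entries, and tensor powers
    of an independent family of functions are independent ([tensor_indep]). *)

(** * Spans and generated subalgebras *)

Section Span.
Context (K : fieldType).

(** The linear span of a family as an inductive predicate: closure properties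
    are then proved by induction, without merging the coefficient functions of
    two finite sums; this merging happens once, in [span_sum]. *)
Inductive lspan (V : lmodType K) (J : Type) (b : J -> V) : V -> Prop :=
| span0 : lspan b 0
| spanS c j v : lspan b v -> lspan b (c *: b j + v).

Lemma span_gen (V : lmodType K) (J : Type) (b : J -> V) j : lspan b (b j).
Proof. by rewrite -[b j]addr0 -[b j]scale1r; apply/spanS/span0. Qed.

Lemma spanD (V : lmodType K) (J : Type) (b : J -> V) u v :
  lspan b u -> lspan b v -> lspan b (u + v).
Proof.
by elim=> [|c j w _ IH] bv; rewrite ?add0r // -addrA; apply/spanS/IH.
Qed.

Lemma span_map (U V : lmodType K) (I J : Type) (b : I -> U) (b' : J -> V)
    (f : U -> V) :
  linear f -> (forall i, lspan b' (f (b i))) ->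
  forall u, lspan b u -> lspan b' (f u).
Proof.
move=> f_lin b'f u; elim=> [|c i w _ IH].
  have := f_lin (-1) 0 0; rewrite scaler0 addr0 scaleN1r addNr => ->.
  exact: span0.
rewrite f_lin; apply: spanD IH; elim: (b'f i) => [|c' j v _ IH].
  by rewrite scaler0; apply: span0.
by rewrite scalerDr scalerA; apply: spanS.
Qed.

Lemma spanZ (V : lmodType K) (J : Type) (b : J -> V) a u :
  lspan b u -> lspan b (a *: u).
Proof.
move=> bu; apply: span_map bu => [c v w|j].
  by rewrite scalerDr !scalerA mulrC.
by rewrite -[_ *: _]addr0; apply/spanS/span0.
Qed.

Lemma spanB (V : lmodType K) (J : Type) (b : J -> V) u v :
  lspan b u -> lspan b v -> lspan b (u - v).
Proof. by move=> bu bv; rewrite -scaleN1r; apply/spanD/spanZ. Qed.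

Lemma spanMn (V : lmodType K) (J : Type) (b : J -> V) u n :
  lspan b u -> lspan b (u *+ n).
Proof. by move=> bu; rewrite -scaler_nat; apply: spanZ. Qed.

Lemma span_trans (V : lmodType K) (I J : Type) (b : I -> V) (b' : J -> V) :
  (forall i, lspan b' (b i)) -> forall v, lspan b v -> lspan b' v.
Proof. exact: (@span_map _ _ _ _ b b' id). Qed.

Lemma spanMl (A : algType K) (I J : Type) (b : I -> A) (b' : J -> A) a :
  (forall i, lspan b' (a * b i)) -> forall v, lspan b v -> lspan b' (a * v).
Proof. by apply: span_map => c u v; rewrite mulrDr scalerAr. Qed.

(** The last clause of [is_basis], recovered from the inductive span. *)
Lemma span_sum (V : lmodType K) (J : eqType) (b : J -> V) v :
  lspan b v -> exists (s : seq J) (c : J -> K), v = \sum_(j <- s) c j *: b j.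
Proof.
suff S: lspan b v -> exists (s : seq J) (c : J -> K),
    uniq s /\ v = \sum_(j <- s) c j *: b j.
  by move=> /S[s [c [_ ->]]]; exists s, c.
elim=> [|a j w _ [s [c [s_uniq ->]]]].
  by exists [::], (fun=> 0); rewrite big_nil.
pose c' k := (if k \in s then c k else 0) + a *+ (k == j).
(* Duplicates are removed so that j receives its new coefficient only once. *)
exists (undup (j :: s)), c'; split; first exact: undup_uniq.
have c'E (r : seq J) : uniq r -> j \in r -> {subset s <= r} ->
    a *: b j + \sum_(k <- s) c k *: b k = \sum_(k <- r) c' k *: b k.
  move=> r_uniq jr sr.
  under [RHS]eq_bigr do rewrite scalerDl.
  rewrite big_split addrC /=; congr (_ + _).
    rewrite [RHS](bigID (mem s)) /= [X in _ + X]big1 ?addr0; last first.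
      by move=> k /negPf ->; rewrite scale0r.
    rewrite -[RHS]big_filter; under [RHS]eq_big_seq => k.
      by rewrite mem_filter => /andP[-> _]; over.
    apply/perm_big/uniq_perm; rewrite ?filter_uniq // => k.
    by rewrite mem_filter /= andbC; case: (boolP (k \in s)) => [/sr->|]; rewrite ?andbF.
  rewrite (bigD1_seq j) //= eqxx big1 ?addr0 // => k /negPf ->.
  by rewrite scale0r.
apply: c'E; rewrite ?undup_uniq ?mem_undup ?mem_head // => k ks.
by rewrite mem_undup inE ks orbT.
Qed.

Section GeneratedSubalgebra.
Context (A : algType K) (G : A -> Prop).

Lemma gen_subalg_gen g : G g -> gen_subalg G g.
Proof. by move=> Gg S _; apply. Qed.

Lemma gen_subalg1 : gen_subalg G 1.
Proof. by move=> S []. Qed.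

Lemma gen_subalgM a b : gen_subalg G a -> gen_subalg G b -> gen_subalg G (a * b).
Proof. by move=> Ga Gb S Salg SG; case: (Salg) => _ _; apply; [apply: Ga|apply: Gb]. Qed.

Lemma gen_subalg_lin c a b :
  gen_subalg G a -> gen_subalg G b -> gen_subalg G (c *: a + b).
Proof. by move=> Ga Gb S Salg SG; case: (Salg) => _ + _; apply; [apply: Ga|apply: Gb]. Qed.

Lemma gen_subalgB a b : gen_subalg G a -> gen_subalg G b -> gen_subalg G (a - b).
Proof. by move=> Ga Gb; rewrite addrC -scaleN1r; apply: gen_subalg_lin. Qed.

Lemma gen_subalgZ c a : gen_subalg G a -> gen_subalg G (c *: a).
Proof.
move=> Ga; rewrite -[_ *: _]addr0; apply: gen_subalg_lin => //.
by rewrite -(subrr 1); apply: gen_subalgB; apply: gen_subalg1.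
Qed.

Lemma gen_subalgX a n : gen_subalg G a -> gen_subalg G (a ^+ n).
Proof.
move=> Ga; elim: n => [|n IH]; first exact: gen_subalg1.
by rewrite exprS; apply: gen_subalgM.
Qed.

Lemma gen_subalg_sub (G' : A -> Prop) a :
  (forall g, G g -> G' g) -> gen_subalg G a -> gen_subalg G' a.
Proof. by move=> GG' Ga S Salg SG'; apply: Ga => // g /GG'/SG'. Qed.

(** A subspace containing 1 that absorbs left multiplication by the generators
    contains the subalgebra: the elements absorbing it on the left form a
    subalgebra. *)
Lemma gen_subalg_span (J : Type) (b : J -> A) :
  lspan b 1 -> (forall g j, G g -> lspan b (g * b j)) ->
  forall a, gen_subalg G a -> lspan b a.
Proof.
move=> b1 Gb a Ga.
pose S := [pred u : A | `[< forall v, lspan b v -> lspan b (u * v) >]].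
(* Apply the absorbing element a to 1. *)
suff /asboolP/(_ 1 b1) : a \in S by rewrite mulr1.
apply: Ga => [|g Gg]; last by apply/asboolP/spanMl => j; apply: Gb.
split=> [|c u v|u v].
- by apply/asboolP => v; rewrite mul1r.
- move=> /asboolP bu /asboolP bv; apply/asboolP => w bw.
  by rewrite mulrDl -scalerAl; apply: spanD (bv _ bw); apply/spanZ/bu.
- move=> /asboolP bu /asboolP bv; apply/asboolP => w bw.
  by rewrite -mulrA; apply/bu/bv.
Qed.

End GeneratedSubalgebra.
End Span.

(** * Rewriting to normal form *)

(** Spanning in one variable only uses three relations between the multiplication
    x, the derivative d and the integration y, so it is done in an arbitrary
    algebra. *)
Section Relations.
Context (K : fieldType) (A : algType K) (x d y : A).
Context (dy : d * y = 1) (dx : d * x = x * d + 1) (ydx : y * (d * x) = x).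

Let H := d * x.
(* The projection onto the constants. *)
Let e0 := 1 - y * d.
Let e k l := y ^+ k * d ^+ l - y ^+ k.+1 * d ^+ l.+1.

Definition normal_form (j : I1_index) : A :=
  match j with
  | inl (inl (p, q)) => x ^+ p * d ^+ q
  | inl (inr (k, l)) => e k l
  | inr st => y ^+ (val st).1 * H ^+ (val st).2
  end.

Lemma d_yS s : d * y ^+ s.+1 = y ^+ s.
Proof. by rewrite exprS mulrA dy mul1r. Qed.

Lemma d_xS p : d * x ^+ p.+1 = x ^+ p.+1 * d + x ^+ p *+ p.+1.
Proof.
elim: p => [|p IH]; first by rewrite expr1 dx.
rewrite exprSr mulrA IH mulrDl -mulrA dx mulrDr mulr1 -addrA -exprSr mulrnAl.
by rewrite mulrA -!exprSr -mulrS.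
Qed.

Lemma H_yX s : H * y ^+ s = y ^+ s * H + y ^+ s *+ s.
Proof.
have Hy : H * y = y * H + y by rewrite /H ydx dx mulrDl mul1r -mulrA dy mulr1.
elim: s => [|s IH]; first by rewrite mulr1 mul1r addr0.
rewrite exprSr mulrA IH mulrDl -mulrA Hy mulrDr mulrA -exprSr mulrnAl -exprSr.
by rewrite -addrA -mulrS.
Qed.

Lemma x_yX s : x * y ^+ s = y ^+ s.+1 * H + y ^+ s.+1 *+ s.
Proof. by rewrite -{1}ydx -mulrA H_yX mulrDr mulrA -exprS mulrnAr -exprS. Qed.

(** The constants form the eigenspace of H for the eigenvalue 1. *)
Lemma H_e0 : H * e0 = e0.
Proof.
rewrite /e0 mulrBr mulr1 mulrA -[y]expr1 H_yX expr1 mulr1n ydx mulrDl.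
by rewrite /H dx opprD addrACA subrr add0r.
Qed.

Lemma d_e0 : d * e0 = 0.
Proof. by rewrite mulrBr mulrA dy mulr1 mul1r subrr. Qed.

Lemma eE k l : e k l = y ^+ k * e0 * d ^+ l.
Proof. by rewrite /e /e0 mulrBr mulr1 mulrBl exprSr exprS !mulrA. Qed.

Lemma x_e k l : x * e k l = e k.+1 l *+ k.+1.
Proof.
rewrite !eE !mulrA x_yX mulrDl -[_ * H * _]mulrA H_e0 mulrDl -mulrnAl.
by rewrite mulrS !mulrDl !mulrnAl.
Qed.

Lemma d_e k l : d * e k l = if k is k'.+1 then e k' l else 0.
Proof.
rewrite eE !mulrA; case: k => [|k]; last by rewrite d_yS eE.
by rewrite mulr1 d_e0 mul0r.
Qed.

Lemma y_e k l : y * e k l = e k.+1 l.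
Proof. by rewrite !eE !mulrA -exprS. Qed.

(* The combinations of the basis elements y^s H^t, t < s, for a fixed s. *)
Let low s := lspan (fun t : 'I_s => y ^+ s * H ^+ t).

Lemma low_gen s t : (t < s)%N -> low s (y ^+ s * H ^+ t).
Proof. by move=> lt_ts; apply: (span_gen _ (Ordinal lt_ts)). Qed.

Lemma low_x s v : low s v -> low s.+1 (x * v).
Proof.
apply: spanMl => t; rewrite mulrA x_yX mulrDl -mulrA -exprS mulrnAl.
by apply: spanD; [|apply: spanMn]; apply: low_gen; rewrite ltnS // ltnW.
Qed.

Lemma low_y s v : low s v -> low s.+1 (y * v).
Proof. by apply: spanMl => t; rewrite mulrA -exprS; apply/low_gen/leqW. Qed.

(** Since x = y H and H y = y (H + 1), x^s is y^s times a monic polynomial of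
    degree s in H.  Hence y^s H^s is x^s up to basis elements: this is where the
    bound t < s in the basis comes from. *)
Lemma xX_low s : low s (x ^+ s - y ^+ s * H ^+ s).
Proof.
elim: s => [|s IH]; first by rewrite !mulr1 subrr; apply: span0.
have -> : x ^+ s.+1 - y ^+ s.+1 * H ^+ s.+1 =
    x * (x ^+ s - y ^+ s * H ^+ s) + (y ^+ s.+1 * H ^+ s) *+ s.
  rewrite mulrBr -exprS mulrA x_yX mulrDl -mulrA -exprS mulrnAl opprD addrA.
  by rewrite subrK.
by apply: spanD (low_x IH) _; apply/spanMn/low_gen.
Qed.

Lemma low_normal_form s v : low s v -> lspan normal_form v.
Proof.
apply: span_trans => t.
exact: (span_gen normal_form (inr (exist _ (s, val t) (ltn_ord t)))).
Qed.

Lemma span_xd p q : lspan normal_form (x ^+ p * d ^+ q).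
Proof. exact: (span_gen normal_form (inl (inl (p, q)))). Qed.

Lemma span_e k l : lspan normal_form (e k l).
Proof. exact: (span_gen normal_form (inl (inr (k, l)))). Qed.

Lemma span_yH s t : (t <= s)%N -> lspan normal_form (y ^+ s * H ^+ t).
Proof.
rewrite leq_eqVlt => /predU1P[->|/low_gen/low_normal_form//].
rewrite -[_ * _](subKr (x ^+ s)).
by apply: spanB (low_normal_form (xX_low s)); rewrite -[x ^+ s]mulr1; apply: (span_xd s 0).
Qed.

Lemma span_y_xX p : lspan normal_form (y * x ^+ p).
Proof.
rewrite -[x ^+ p](subrK (y ^+ p * H ^+ p)) mulrDr mulrA -exprS.
by apply: spanD (span_yH (leqnSn p)); apply/low_normal_form/low_y/xX_low.
Qed.

(** Integration by parts: y x^(p+1) d = x^(p+1) - (p+1) y x^p, while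
    y d = 1 - e_00 when there is no power of x. *)
Lemma span_y_xd p q : lspan normal_form (y * (x ^+ p * d ^+ q)).
Proof.
case: q => [|q]; first by rewrite mulr1; apply: span_y_xX.
elim: p q => [|p IH] q.
  have -> : y * (x ^+ 0 * d ^+ q.+1) = x ^+ 0 * d ^+ q - e 0 q.
    by rewrite /e !mul1r expr1 subKr.
  by apply: spanB (span_e _ _); apply: span_xd.
have -> : y * (x ^+ p.+1 * d ^+ q.+1) =
    x ^+ p.+1 * d ^+ q - (y * (x ^+ p * d ^+ q)) *+ p.+1.
  have -> : x ^+ p.+1 * d ^+ q.+1 =
      d * x ^+ p.+1 * d ^+ q - (x ^+ p * d ^+ q) *+ p.+1.
    by rewrite d_xS mulrDl -mulrA -exprS mulrnAl addrK.
  have yd_x : y * (d * x ^+ p.+1) = x ^+ p.+1.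
    by rewrite exprS (mulrA d) mulrA ydx.
  by rewrite mulrBr (mulrA y (d * _)) yd_x mulrnAr.
apply: spanB (span_xd _ _) (spanMn _ _).
by case: q => [|q]; [rewrite mulr1; apply: span_y_xX|apply: IH].
Qed.

Lemma span_normal_form1 : lspan normal_form 1.
Proof. by rewrite -[1]mulr1; apply: (span_xd 0 0). Qed.

Lemma span_normal_form_mul g j : [\/ g = x, g = d | g = y] ->
  lspan normal_form (g * normal_form j).
Proof.
case: j => [[[p q]|[k l]]|[[s t] /= lt_ts]] /= [] ->.
- by rewrite mulrA -exprS; apply: span_xd.
- case: p => [|p]; first by rewrite mul1r -exprS -[_ ^+ _]mul1r; apply: (span_xd 0).
  rewrite mulrA d_xS mulrDl -mulrA -exprS mulrnAl.
  by apply: spanD; [|apply: spanMn]; apply: span_xd.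
- exact: span_y_xd.
- by rewrite x_e; apply/spanMn/span_e.
- by rewrite d_e; case: k => [|k]; [apply: span0|apply: span_e].
- by rewrite y_e; apply: span_e.
- by apply/low_normal_form/low_x/low_gen.
- by case: s lt_ts => // s lt_ts; rewrite mulrA d_yS; apply: span_yH.
- by apply/low_normal_form/low_y/low_gen.
Qed.

Lemma gen_subalg_normal_form a :
  gen_subalg (fun g => [\/ g = x, g = d | g = y]) a -> lspan normal_form a.
Proof.
apply: gen_subalg_span span_normal_form1 _ a => g j.
exact: span_normal_form_mul.
Qed.

Lemma normal_form_gen_subalg j :
  gen_subalg (fun g => [\/ g = x, g = d | g = y]) (normal_form j).
Proof.
have [Gx Gd Gy] : [/\ gen_subalg (fun g => [\/ g = x, g = d | g = y]) x,
    gen_subalg (fun g => [\/ g = x, g = d | g = y]) d &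
    gen_subalg (fun g => [\/ g = x, g = d | g = y]) y].
  by split; apply: gen_subalg_gen; [apply: Or31|apply: Or32|apply: Or33].
by case: j => [[[p q]|[k l]]|[[s t] _]] /=; [|apply: gen_subalgB|];
  apply: gen_subalgM; do ?apply: gen_subalgX => //; apply: gen_subalgM.
Qed.

End Relations.

(** * Linear independence *)

(** Polynomials of distinct degrees are independent: by descending induction on
    the degree, the coefficient of the sum in degree [deg j] is [c j] times the
    leading coefficient of [P j]. *)
Lemma poly_indep (K : fieldType) (J : eqType) (P : J -> {poly K})
    (deg : J -> nat) (s : seq J) (c : J -> K) :
  uniq s -> {in s &, injective deg} -> (forall j, size (P j) = (deg j).+1) ->
  \sum_(j <- s) c j *: P j = 0 -> forall j, j \in s -> c j = 0.
Proof.
move=> s_uniq deg_inj sizeP sum0.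
pose B := (\max_(j <- s) deg j)%N.
have leB j : j \in s -> (deg j <= B)%N.
  by move=> js; apply: (@leq_bigmax_seq _ s xpredT deg j).
suff ind k j : j \in s -> (B - deg j < k)%N -> c j = 0.
  by move=> j js; apply: (ind (B - deg j).+1 j).
elim: k j => // k IH j js; rewrite ltnS => le_k.
have := congr1 (fun p : {poly K} => p`_(deg j)) sum0.
rewrite coef_sum coef0 (bigD1_seq j) //= big1_seq ?addr0 => [|i /andP[ij si]].
  rewrite coefZ; move/eqP; rewrite mulf_eq0 => /predU1P[//|].
  have -> : deg j = (size (P j)).-1 by rewrite sizeP.
  by rewrite -lead_coefE lead_coef_eq0 -size_poly_eq0 sizeP.
rewrite coefZ; have [lt_ij|lt_ji|/deg_inj eq_ij] := ltngtP (deg i) (deg j).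
- by rewrite nth_default ?mulr0 // sizeP.
- by rewrite IH ?mul0r // (leq_trans _ le_k) // ltn_sub2l // (leq_trans lt_ji) ?leB.
- by rewrite eq_ij ?eqxx in ij.
Qed.

(** Tensor powers of an independent family of functions are independent: freeze
    all variables but one, use independence in that variable to fix the
    corresponding index, and repeat with the next variable. *)
Lemma tensor_indep (K : fieldType) (J : eqType) (X : Type) (x0 : X)
    (F : J -> X -> K) :
  (forall (s : seq J) (c : J -> K), uniq s ->
     (forall x, \sum_(j <- s) c j * F j x = 0) ->
     forall j, j \in s -> c j = 0) ->
  forall (n : nat) (s : seq {ffun 'I_n -> J}) (c : {ffun 'I_n -> J} -> K),
    uniq s ->
    (forall x : 'I_n -> X, \sum_(w <- s) c w * \prod_i F (w i) (x i) = 0) ->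
    forall w, w \in s -> c w = 0.
Proof.
move=> F_indep n s c s_uniq sum0.
pose agree k (v w : {ffun 'I_n -> J}) := [forall i : 'I_n, (i < k)%N ==> (w i == v i)].
(* The indices of the first k factors are those of v, the variables of these
   factors are gone. *)
suff peel k : (k <= n)%N -> forall v (x : 'I_n -> X),
    \sum_(w <- s | agree k v w) c w * \prod_(i : 'I_n | (k <= i)%N) F (w i) (x i) = 0.
  move=> v sv.
  have := peel n (leqnn n) v (fun=> x0).
  rewrite -big_filter (_ : filter _ s = [:: v]).
    by rewrite big_seq1 big_pred0 ?mulr1 // => i; rewrite leqNgt ltn_ord.
  rewrite (@eq_filter _ _ (pred1 v)) ?filter_pred1_uniq // => w.
  apply/forallP/eqP => [wv|-> i]; last by rewrite eqxx implybT.
  by apply/ffunP => i; move: (wv i); rewrite ltn_ord => /eqP.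
elim: k => [_ v x|k IH lt_kn v x].
  rewrite -[RHS](sum0 x) [LHS]big_mkcond /=; apply: eq_bigr => w _.
  have -> : agree 0%N v w by apply/forallP.
  by [].
pose i0 := Ordinal lt_kn.
pose g w := c w * \prod_(i : 'I_n | (k < i)%N) F (w i) (x i).
pose c' j := \sum_(w <- s | agree k v w && (w i0 == j)) g w.
have agreeS w : agree k.+1 v w = agree k v w && (w i0 == v i0).
  apply/forallP/andP => [wv|[/forallP wv /eqP wv0] i].
    split; last by have := wv i0; rewrite ltnSn.
    by apply/forallP => i; apply/implyP => /ltnW ik; apply: (implyP (wv i)).
  rewrite ltnS leq_eqVlt; apply/implyP => /predU1P[ik|ik].
    by rewrite (_ : i = i0) ?wv0 //; apply: val_inj.
  exact: (implyP (wv i)).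
rewrite (eq_bigl _ _ agreeS) -/(c' (v i0)).
pose s' := undup [seq (w : {ffun 'I_n -> J}) i0 | w <- s].
have s'_w w : w \in s -> w i0 \in s' by move=> sw; rewrite mem_undup; apply/mapP; exists w.
have [vs'|vs'] := boolP (v i0 \in s'); last first.
  rewrite /c' big1_seq // => w /andP[/andP[_ /eqP wv] sw].
  by move: vs'; rewrite -wv s'_w.
apply: F_indep vs'; first exact: undup_uniq.
move=> y; pose x' i := if i == i0 then y else x i.
rewrite -[RHS](IH (ltnW lt_kn) v x') /c'.
under eq_bigr do rewrite big_distrl big_mkcond /=.
rewrite exchange_big [RHS]big_mkcond /=; apply: eq_big_seq => w sw.
have [kw|] := boolP (agree k v w); last by rewrite big1.
rewrite (bigD1_seq (w i0)) ?undup_uniq ?s'_w //= eqxx big1 ?addr0.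
  rewrite [in RHS](bigD1 i0) //= {1}/x' eqxx mulrCA mulrC; congr (_ * _).
  rewrite /g; congr (_ * _); apply: eq_big => [i|i].
    by rewrite ltn_neqAle andbC eq_sym.
  by rewrite /x'; case: eqP => // ->; rewrite ltnn.
by move=> j; rewrite eq_sym => /negPf ->.
Qed.

Section Entries.
Context (K : fieldType) (charK : [pchar K] =i pred0).

Lemma natf_eq0 n : (n%:R == 0 :> K) = (n == 0)%N.
Proof. by move/pcharf0P: charK => ->. Qed.

Lemma natf_inj : injective (fun n => n%:R : K).
Proof.
suff sub m n : (m <= n)%N -> m%:R = n%:R :> K -> m = n.
  by move=> m n; case: (leqP m n) => [/sub //|/ltnW/sub inj /esym/inj].
move=> le_mn /esym/eqP; rewrite -subr_eq0 -natrB // natf_eq0 subn_eq0 => le_nm.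
by apply/eqP; rewrite eqn_leq le_mn.
Qed.

Lemma poly_eq0_large (p : {poly K}) N0 :
  (forall N, (N0 <= N)%N -> p.[N%:R] = 0) -> p = 0.
Proof.
move=> p0; apply: (@roots_geq_poly_eq0 _ p [seq i%:R | i <- iota N0 (size p)]).
- by apply/allP => _ /mapP[i + ->]; rewrite mem_iota => /andP[/p0 /rootP].
- by rewrite map_inj_uniq ?iota_uniq //; apply: natf_inj.
- by rewrite size_map size_iota.
Qed.

(** In one variable, every basis element sends the divided power x^m/m! to
    [action_coef j m] times the divided power of exponent [action_shift j m];
    [acts_I1_basis] proves this.  For x^p d^q with m < q the coefficient is 0, so
    the truncated subtraction in [action_shift] is harmless. *)
Definition action_coef (j : I1_index) (m : nat) : K :=
  match j with
  | inl (inl (p, q)) => ((m - q + p) ^_ p)%:R *+ (q <= m)%N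
  | inl (inr (k, l)) => (m == l)%:R
  | inr st => m.+1%:R ^+ (val st).2
  end.

Definition action_shift (j : I1_index) (m : nat) : nat :=
  match j with
  | inl (inl (p, q)) => m - q + p
  | inl (inr (k, l)) => k
  | inr st => m + (val st).1
  end.

(** The entry of the matrix of a basis element in column [mr.1], row [mr.2]. *)
Definition entry j (mr : nat * nat) : K :=
  action_coef j mr.1 *+ (action_shift j mr.1 == mr.2).

Definition degree (j : I1_index) : nat :=
  match j with
  | inl (inl (p, _)) => p
  | inl (inr _) => 0
  | inr st => (val st).2
  end.

(** Far down each diagonal the entries of x^p d^q and y^s H^t are values of this
    polynomial at the row number; those of e_kl vanish there, and the
    constant 1 keeps [size_symbol] uniform. *)
Definition symbol (j : I1_index) : {poly K} :=
  match j with
  | inl (inl (p, _)) => \prod_(i < p) ('X - i%:R%:P)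
  | inl (inr _) => 1
  | inr st => ('X - ((val st).1%:R - 1)%:P) ^+ (val st).2
  end.

(** The basis element shifts degrees by v - u.  The finite-rank e_kl are put on no
    diagonal. *)
Definition on_diag (u v : nat) (j : I1_index) : bool :=
  match j with
  | inl (inl (p, q)) => v + q == u + p
  | inl (inr _) => false
  | inr st => v == u + (val st).1
  end.

(** How far down its diagonal a matrix entry becomes polynomial in the row number,
    see [entry_far]. *)
Definition onset (j : I1_index) : nat :=
  match j with
  | inl (inl (_, q)) => q
  | inl (inr (_, l)) => l.+1
  | inr _ => 0
  end.

Lemma size_symbol j : size (symbol j) = (degree j).+1.
Proof.
case: j => [[[p q]|[k l]]|st] /=; last by rewrite size_exp_XsubC.
- rewrite -(big_mkord xpredT (fun i => 'X - i%:R%:P)).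
  by rewrite size_prod_XsubC size_iota subn0.
- by rewrite size_poly1.
Qed.

Lemma ffact_horner p r : (r ^_ p)%:R = (\prod_(i < p) ('X - i%:R%:P)).[r%:R] :> K.
Proof.
rewrite horner_prod; elim: p => [|p IH]; first by rewrite big_ord0.
rewrite big_ord_recr /= -IH ffactnSr natrM hornerXsubC.
have [le_pr|lt_rp] := leqP p r; first by rewrite natrB.
by rewrite ffact_small // !mul0r.
Qed.

Lemma entry_far u v j N : (onset j <= N)%N ->
  entry j (N + u, N + v)%N = (symbol j).[(N + v)%:R] *+ on_diag u v j.
Proof.
rewrite /entry; case: j => [[[p q]|[k l]]|[[s t] lt_ts]] /= le_N.
- have -> : (N + u - q + p == N + v)%N = (v + q == u + p)%N by lia.
  case: eqP => // e; rewrite (_ : q <= N + u)%N ?ffact_horner; last by lia.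
  by rewrite (_ : N + u - q + p = N + v)%N //; lia.
- by rewrite (_ : (N + u == l)%N = false) ?mul0rn //; lia.
- rewrite -addnA eqn_add2l eq_sym; case: eqP => // ->.
  by rewrite horner_exp hornerXsubC addnA natrD opprB addrCA addrK -natr1 addrC.
Qed.

(** On a given diagonal the degrees are distinct: there y^s H^t has degree t < s,
    and x^p d^q has degree p = s + q >= s. *)
Lemma degree_inj u v j j' :
  on_diag u v j -> on_diag u v j' -> degree j = degree j' -> j = j'.
Proof.
case: j => [[[p q]|[k l]]|[[s t] lt_ts]] //=;
  case: j' => [[[p' q']|[k' l']]|[[s' t'] lt_ts']] //= /eqP e /eqP e' ee.
- by have [-> ->] : p = p' /\ q = q' by lia.
- by exfalso; simpl in *; lia.
- by exfalso; simpl in *; lia.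
- congr inr; apply: val_inj => /=; congr (_, _); lia.
Qed.

(** The coefficients of x^p d^q and y^s H^t vanish by [poly_indep] applied along
    each diagonal; the remaining e_kl are matrix units. *)
Lemma entry_indep (s : seq I1_index) (c : I1_index -> K) : uniq s ->
  (forall mr, \sum_(j <- s) c j * entry j mr = 0) ->
  forall j, j \in s -> c j = 0.
Proof.
move=> s_uniq sum0.
have cdiag u v j : j \in s -> on_diag u v j -> c j = 0.
  move=> sj jd; pose s' := filter (on_diag u v) s.
  apply: (@poly_indep _ _ symbol degree s' c).
  - by rewrite filter_uniq.
  - move=> i i'; rewrite !mem_filter => /andP[di _] /andP[di' _].
    exact: degree_inj di di'.
  - exact: size_symbol.
  - apply: (@poly_eq0_large _ (\max_(i <- s) onset i + v)%N) => N' le_N.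
    have [N eN] : exists N, N' = (N + v)%N by exists (N' - v)%N; lia.
    rewrite {N'}eN leq_add2r in le_N *.
    rewrite horner_sum big_filter big_mkcond /= -[RHS](sum0 (N + u, N + v)%N).
    apply: eq_big_seq => i si; rewrite entry_far; last first.
      by apply: leq_trans le_N; apply: leq_bigmax_seq.
    by rewrite hornerZ; case: on_diag; rewrite ?mulr0.
  - by rewrite mem_filter jd.
case=> [[[p q]|[k l]]|[[r t] lt]] sj.
- by apply: (cdiag q p _ sj); apply/eqP/addnC.
- have := sum0 (l, k); rewrite (bigD1_seq _ sj) //= {1}/entry /= !eqxx mulr1.
  rewrite big1_seq ?addr0 // => i /andP[ij si].
  move: i si ij => [[[p' q']|[k' l']]|[[r' t'] lt']] si ij.
  + by rewrite (cdiag q' p' _ si) ?mul0r //; apply/eqP/addnC.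
  + rewrite /entry /=; have [el|] := eqVneq l l'; last by rewrite mul0rn mulr0.
    have [ek|] := eqVneq k' k; last by rewrite mulr0.
    by rewrite el ek eqxx in ij.
  + by rewrite (cdiag 0%N r' _ si) ?mul0r //; apply/eqP.
- by apply: (cdiag 0%N r _ sj); apply/eqP.
Qed.

End Entries.

(** * Action on divided powers *)

Section Action.
Context (K : fieldType) (charK : [pchar K] =i pred0) (n : nat).
Local Notation P := {mpoly K[n]}.
Implicit Types (i k : 'I_n) (m : 'X_{1..n}) (f g : lend P).

(** The divided power x^m/m!, on which differentiation and integration act by pure
    shifts.  It is locked so that rewriting with linearity or associativity of
    scaling does not open it. *)
Definition dpow m : P := locked ((\prod_(i < n) (m i)`!)%:R^-1 *: 'X_[m]).

Lemma dpowE m : dpow m = (\prod_(i < n) (m i)`!)%:R^-1 *: 'X_[m].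
Proof. by rewrite /dpow -lock. Qed.

Definition upd m i r : 'X_{1..n} := [multinom if k == i then r else m k | k < n].

Lemma updE m i r k : upd m i r k = if k == i then r else m k.
Proof. exact: mnmE. Qed.

Lemma upd_id m i : upd m i (m i) = m.
Proof. by apply/mnmP => k; rewrite updE; case: eqP => // ->. Qed.

Lemma upd_upd m i r r' : upd (upd m i r) i r' = upd m i r'.
Proof. by apply/mnmP => k; rewrite !updE; case: eqP. Qed.

Lemma updC m i k r r' : i != k -> upd (upd m i r) k r' = upd (upd m k r') i r.
Proof.
move=> ik; apply/mnmP => l; rewrite !updE.
by case: (eqVneq l i) => // ->; rewrite (negPf ik).
Qed.

Lemma fact_neq0 m : (\prod_(i < n) (m i)`!)%:R != 0 :> K.
Proof.
by rewrite natf_eq0 // -lt0n; apply: prodn_gt0 => i; apply: fact_gt0.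
Qed.

Lemma fact_upd m i :
  (\prod_(k < n) (upd m i (m i).+1 k)`! = (m i).+1 * \prod_(k < n) (m k)`!)%N.
Proof.
rewrite (bigD1 i) //= [in RHS](bigD1 i) //= updE eqxx factS mulnA; congr (_ * _)%N.
by apply: eq_bigr => k /negPf ki; rewrite updE ki.
Qed.

Lemma monomialE m : 'X_[m] = (\prod_(i < n) (m i)`!)%:R *: dpow m.
Proof. by rewrite dpowE scalerA divff ?scale1r // fact_neq0. Qed.

Lemma lendZr f c v : f (c *: v) = c *: f v.
Proof. exact: (linearZZ (f : {linear P -> P})). Qed.

Lemma lendM f g v : lend_fun (f * g) v = f (g v). Proof. by []. Qed.
Lemma lend1E v : lend_fun (1 : lend P) v = v. Proof. by []. Qed.
Lemma lendD f g v : lend_fun (f + g) v = f v + g v. Proof. by []. Qed.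
Lemma lendB f g v : lend_fun (f - g) v = f v - g v. Proof. by []. Qed.
Lemma lendZl c f v : lend_fun (c *: f) v = c *: f v. Proof. by []. Qed.

Lemma lendr_sum (J : Type) (s : seq J) f (F : J -> P) :
  f (\sum_(j <- s) F j) = \sum_(j <- s) f (F j).
Proof. exact: (linear_sum (f : {linear P -> P})). Qed.

Lemma lend_dpow f g : (forall m, f (dpow m) = g (dpow m)) -> f = g.
Proof.
move=> fg; apply: lendP => p; rewrite [p]mpolyE.
rewrite !lendr_sum.
apply: eq_bigr => m _; rewrite monomialE scalerA.
by rewrite (lendZr f) (lendZr g) fg.
Qed.

Lemma lend_sumE (J : Type) (s : seq J) (F : J -> lend P) v :
  lend_fun (\sum_(j <- s) F j) v = \sum_(j <- s) F j v.
Proof. by apply: (big_morph (fun f : lend P => lend_fun f v)). Qed.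

(** The operator acts on the i-th exponent only, as a weighted shift of divided
    powers: all operators in play have this form. *)
Definition acts i f (a : nat -> K) (t : nat -> nat) :=
  forall m, f (dpow m) = a (m i) *: dpow (upd m i (t (m i))).

(** The shift is irrelevant where the weight is 0. *)
Lemma acts_eq i f a t a' t' : acts i f a t -> a =1 a' ->
  (forall r, a r != 0 -> t r = t' r) -> acts i f a' t'.
Proof.
move=> ft aa' tt' m; rewrite ft -aa'; have [->|/tt' ->//] := eqVneq (a (m i)) 0.
by rewrite !scale0r.
Qed.

Lemma acts_mul i f g a t a' t' : acts i f a t -> acts i g a' t' ->
  acts i (f * g) (fun r => a' r * a (t' r)) (fun r => t (t' r)).
Proof.
move=> ft gt m; rewrite lendM gt (lendZr f) ft scalerA updE eqxx.
by rewrite upd_upd.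
Qed.

Lemma acts1 i : acts i 1 (fun=> 1) id.
Proof. by move=> m; rewrite scale1r upd_id. Qed.

Lemma acts_comm i k f g a t a' t' : i != k ->
  acts i f a t -> acts k g a' t' -> f * g = g * f.
Proof.
move=> ik ft gt; apply: lend_dpow => m.
rewrite !lendM.
rewrite gt ft (lendZr f) (lendZr g) ft gt !scalerA !updE.
by rewrite (negPf ik) [k == i]eq_sym (negPf ik) (updC _ _ _ ik) mulrC.
Qed.

Lemma upd_add m i : upd m i (m i).+1 = (U_(i) + m)%MM.
Proof.
apply/mnmP => k; rewrite updE mnmDE mnm1E eq_sym.
by case: eqP => [->|].
Qed.

Lemma natfS_neq0 r : r.+1%:R != 0 :> K.
Proof. by rewrite natf_eq0. Qed.

Lemma op_intE i p : lend_fun (op_int K i) p = mint i p. Proof. by []. Qed.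
Lemma op_xE i p : lend_fun (op_x K i) p = 'X_i * p. Proof. by []. Qed.
Lemma op_dE i p : lend_fun (op_d K i) p = mderiv i p. Proof. by []. Qed.

Lemma acts_int i : acts i (op_int K i) (fun=> 1) S.
Proof.
move=> m; rewrite scale1r !dpowE lendZr op_intE mintX.
by rewrite scalerA fact_upd upd_add mpolyXD natrM invfM mulrC.
Qed.

Lemma acts_x i : acts i (op_x K i) (fun r => r.+1%:R) S.
Proof.
move=> m; rewrite !dpowE lendZr op_xE fact_upd upd_add.
by rewrite mpolyXD natrM invfM scalerA mulrA divff ?mul1r ?natfS_neq0.
Qed.

Lemma acts_d i : acts i (op_d K i) (fun r => (0 < r)%:R) predn.
Proof.
move=> m; rewrite [dpow m]dpowE lendZr op_dE mderivX.
case mi: (m i) => [|r]; first by rewrite !scale0r scaler0.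
have -> : (m - U_(i))%MM = upd m i r.
  apply/mnmP => k; rewrite updE mnmBE mnm1E eq_sym.
  by case: eqP => [->|_]; rewrite ?subn0 // mi subn1.
have := fact_upd (upd m i r) i; rewrite upd_upd updE eqxx -mi upd_id mi => ->.
by rewrite scale1r scalerA [in RHS]dpowE natrM invfM mulrAC mulVf ?mul1r ?natfS_neq0.
Qed.

Lemma d_int i : op_d K i * op_int K i = 1.
Proof.
apply: lend_dpow => m; rewrite (acts_mul (acts_d i) (acts_int i)) mulr1.
by rewrite scale1r upd_id.
Qed.

Lemma acts_H i : acts i (op_H K i) (fun r => r.+1%:R) id.
Proof.
by apply: acts_eq (acts_mul (acts_d i) (acts_x i)) _ _ => r; rewrite ?mulr1.
Qed.

Lemma d_x i : op_d K i * op_x K i = op_x K i * op_d K i + 1.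
Proof.
apply: lend_dpow => m; rewrite acts_H lendD.
rewrite (acts_mul (acts_x i) (acts_d i)) lend1E upd_id.
case mi: (m i) => [|r] /=; first by rewrite mul0r scale0r add0r scale1r.
by rewrite mul1r -mi upd_id mi -[r.+2%:R]natr1 scalerDl scale1r.
Qed.

Lemma int_d_x i : op_int K i * (op_d K i * op_x K i) = op_x K i.
Proof.
apply: lend_dpow => m; rewrite (acts_mul (acts_int i) (acts_H i)) mulr1.
by rewrite acts_x.
Qed.

Lemma acts_expr i f a t r : acts i f a t ->
  acts i (f ^+ r) (fun u => \prod_(j < r) a (iter j t u)) (iter r t).
Proof.
move=> ft; elim: r => [|r IH].
  by apply: acts_eq (acts1 i) _ _ => // u; rewrite big_ord0.
rewrite exprS; apply: acts_eq (acts_mul ft IH) _ _ => // u.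
by rewrite big_ord_recr.
Qed.

Lemma iter_succ r u : iter r S u = (u + r)%N.
Proof. by elim: r => [|r IH]; rewrite ?addn0 //= IH addnS. Qed.

Lemma iter_pred r u : iter r predn u = (u - r)%N.
Proof. by elim: r => [|r IH]; rewrite ?subn0 //= IH -subnS. Qed.

Lemma acts_xX i p : acts i (op_x K i ^+ p) (fun u => ((u + p) ^_ p)%:R) (addn^~ p).
Proof.
apply: acts_eq (acts_expr p (acts_x i)) _ _ => u; last by rewrite iter_succ.
elim: p => [|p IH]; first by rewrite big_ord0.
by rewrite big_ord_recr /= IH iter_succ -natrM addnS ffactSS mulnC.
Qed.

Lemma acts_intX i s : acts i (op_int K i ^+ s) (fun=> 1) (addn^~ s).
Proof.
apply: acts_eq (acts_expr s (acts_int i)) _ _ => u; last by rewrite iter_succ.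
by rewrite big1.
Qed.

Lemma acts_dX i q : acts i (op_d K i ^+ q) (fun u => (q <= u)%:R) (subn^~ q).
Proof.
apply: acts_eq (acts_expr q (acts_d i)) _ _ => u; last by rewrite iter_pred.
elim: q => [|q IH]; first by rewrite big_ord0.
rewrite big_ord_recr /= IH iter_pred subn_gt0 -natrM mulnb.
by congr (nat_of_bool _)%:R; lia.
Qed.

Lemma acts_HX i t : acts i (op_H K i ^+ t) (fun u => u.+1%:R ^+ t) id.
Proof.
have iter_id r (u : nat) : iter r id u = u by elim: r.
apply: acts_eq (acts_expr t (acts_H i)) _ _ => u; last by rewrite iter_id.
by under eq_bigr do rewrite iter_id; rewrite prodr_const card_ord.
Qed.

Lemma acts_I1_basis i j : acts i (I1_basis K i j) (action_coef K j) (action_shift j).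
Proof.
case: j => [[[p q]|[k l]]|[[s t] /= lt_ts]].
- apply: acts_eq (acts_mul (acts_xX i p) (acts_dX i q)) _ _ => //= u.
  by rewrite mulr_natl.
- move=> m.
  have acts_k (k' l' : nat) : acts i (op_int K i ^+ k' * op_d K i ^+ l')
      (fun u => (l' <= u)%:R) (fun u => u - l' + k')%N.
    by apply: acts_eq (acts_mul (acts_intX i k') (acts_dX i l')) _ _ => // u; rewrite mulr1.
  have -> : I1_basis K i (inl (inr (k, l))) = op_int K i ^+ k * op_d K i ^+ l
      - op_int K i ^+ k.+1 * op_d K i ^+ l.+1 by [].
  rewrite lendB !acts_k /=.
  have [lt_ml|lt_lm|->] := ltngtP (m i) l.
  + by rewrite !scale0r subr0.
  + by rewrite addnS -addSn subnSK // subrr scale0r.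
  + by rewrite subnn add0n scale0r subr0.
- by apply: acts_eq (acts_mul (acts_intX i s) (acts_HX i t)) _ _ => //= u; rewrite mulr1.
Qed.

Lemma basis_prod_acts (w : 'I_n -> I1_index) m :
  lend_fun (\prod_(i < n) I1_basis K i (w i)) (dpow m) =
  (\prod_(i < n) action_coef K (w i) (m i)) *:
  dpow [multinom action_shift (w i) (m i) | i < n].
Proof.
suff H (r : seq 'I_n) : uniq r -> lend_fun (\prod_(i <- r) I1_basis K i (w i)) (dpow m) =
    (\prod_(i <- r) action_coef K (w i) (m i)) *:
    dpow [multinom if i \in r then action_shift (w i) (m i) else m i | i < n].
  rewrite H ?index_enum_uniq //; congr (_ *: dpow _).
  by apply/mnmP => i; rewrite !mnmE mem_index_enum.
elim: r => [_|i r IH /= /andP[ir r_uniq]].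
  rewrite !big_nil scale1r; congr dpow.
  by apply/mnmP => i; rewrite mnmE.
rewrite !big_cons lendM IH // lendZr.
rewrite acts_I1_basis mnmE (negPf ir) scalerA mulrC; congr (_ *: dpow _).
apply/mnmP => k; rewrite updE !mnmE inE.
by case: eqVneq => [->|].
Qed.

Lemma dpow_coeff m m' :
  (dpow m)@_m' = (\prod_(i < n) (m' i)`!)%:R^-1 * (m == m')%:R.
Proof. by rewrite dpowE mcoeffZ mcoeffX; case: eqP => [->|]; rewrite ?mulr0. Qed.

(** The matrix entries of a product are products of one-variable entries, up to a
    common non-zero factorial, so [tensor_indep] applies. *)
Lemma basis_prod_indep (s : seq {ffun 'I_n -> I1_index})
    (c : {ffun 'I_n -> I1_index} -> K) : uniq s ->
  \sum_(w <- s) c w *: (\prod_(i < n) I1_basis K i (w i) : lend P) = 0 ->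
  forall w, w \in s -> c w = 0.
Proof.
move=> s_uniq sum0.
apply: (tensor_indep (0, 0)%N (entry_indep charK) s_uniq) => x.
pose m := [multinom (x i).1 | i < n]; pose m' := [multinom (x i).2 | i < n].
have := congr1 (fun f : lend P => (lend_fun f (dpow m))@_m') sum0.
rewrite lend_sumE; under eq_bigr do rewrite lendZl basis_prod_acts scalerA.
rewrite [lend_fun 0 _](_ : _ = 0) // mcoeff0 raddf_sum /=.
under eq_bigr do rewrite mcoeffZ dpow_coeff mulrCA -mulrA.
rewrite -mulr_sumr => /eqP; rewrite mulf_eq0 invr_eq0 (negPf (fact_neq0 _)) /=.
move=> /eqP sum'; rewrite -[RHS]sum'; apply: eq_bigr => w _.
congr (_ * _); have [e|ne] := eqVneq.
  rewrite mulr1; apply: eq_bigr => i _; rewrite /entry mnmE.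
  by move/mnmP/(_ i): e; rewrite !mnmE => ->; rewrite eqxx.
rewrite mulr0; have [/forallP e|/forallPn[i ne_i]] :=
    boolP [forall i, action_shift (w i) (x i).1 == (x i).2].
  by case/eqP: ne; apply/mnmP => i; rewrite !mnmE; apply/eqP.
by rewrite (bigD1 i) //= /entry (negPf ne_i) mul0r.
Qed.

(** * Bases of the factors and of their product *)

Lemma alg_I1_sub i f : alg_I1 i f -> alg_I f.
Proof. by apply: gen_subalg_sub => g; exists i. Qed.

Lemma I1_basisE i : I1_basis K i =1 normal_form (op_x K i) (op_d K i) (op_int K i).
Proof. by case=> [[[p q]|[k l]]|st]. Qed.

Lemma alg_I1_basis i j : alg_I1 i (I1_basis K i j).
Proof. by rewrite I1_basisE; apply: normal_form_gen_subalg. Qed.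

(** A basis element of the i-th factor as a product of basis elements, the other
    factors being 1 = x^0 d^0. *)
Definition single i j : {ffun 'I_n -> I1_index} :=
  [ffun k => if k == i then j else inl (inl (0, 0)%N)].

Lemma basis_single i j : \prod_k I1_basis K k (single i j k) = I1_basis K i j.
Proof.
transitivity (\prod_(k | k == i) I1_basis K k (single i j k)).
  rewrite [RHS]big_mkcond; apply: eq_bigr => k _; rewrite ffunE.
  by case: eqP => //= _; rewrite mulr1.
by rewrite big_pred1_eq ffunE eqxx.
Qed.

Definition tensor_basis (w : {ffun 'I_n -> I1_index}) : lend P :=
  \prod_(i < n) I1_basis K i (w i).

(** A generator with index i commutes with the factors in front of the i-th one,
    so it can be moved there, where the one-variable rewriting applies. *)
Lemma span_tensor_mul i (g : lend P) w :
  [\/ g = op_x K i, g = op_d K i | g = op_int K i] ->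
  lspan tensor_basis (g * tensor_basis w).
Proof.
move=> Gg.
have [a [t gt]] : exists a t, acts i g a t.
  by case: Gg => ->; do 2 eexists; [apply: acts_x|apply: acts_d|apply: acts_int].
have [s1 [s2 enumE]] : exists s1 s2, index_enum 'I_n = s1 ++ i :: s2.
  by case/splitPr: (mem_index_enum i) => s1 s2; exists s1, s2.
have : uniq (index_enum 'I_n) by apply: index_enum_uniq.
rewrite enumE uniq_catC /= mem_cat negb_or => /andP[/andP[is2 is1] _].
pose L := \prod_(k <- s1) I1_basis K k (w k).
pose R := \prod_(k <- s2) I1_basis K k (w k).
have updateE j : L * I1_basis K i j * R =
    tensor_basis [ffun k => if k == i then j else w k].
  rewrite /tensor_basis enumE big_cat big_cons /= ffunE eqxx mulrA.
  congr (_ * _ * _); apply: eq_big_seq => k ks; rewrite ffunE; case: eqP => // ki.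
    by rewrite -ki ks in is1.
  by rewrite -ki ks in is2.
have gL : g * L = L * g.
  rewrite /L; elim: (s1) is1 => [_|k s IH]; first by rewrite big_nil mulr1 mul1r.
  rewrite inE negb_or big_cons => /andP[ik /IH IHs].
  by rewrite mulrA (acts_comm ik gt (acts_I1_basis k (w k))) -!mulrA IHs.
have -> : g * tensor_basis w = L * (g * I1_basis K i (w i)) * R.
  by rewrite /tensor_basis enumE big_cat big_cons /= mulrA gL !mulrA.
apply: (@span_map _ _ _ _ _ (I1_basis K i) _ (fun h => L * h * R)).
- by move=> c u v /=; rewrite mulrDr mulrDl -scalerAr -scalerAl.
- by move=> j; rewrite updateE; apply: span_gen.
- rewrite I1_basisE; apply: span_trans (span_normal_form_mul _ _ _ _ Gg).
  + by move=> j; rewrite -I1_basisE; apply: span_gen.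
  + exact: d_int.
  + exact: d_x.
  + exact: int_d_x.
Qed.

Lemma alg_I_span f : alg_I f -> lspan tensor_basis f.
Proof.
apply: gen_subalg_span => [|g w [i Gg]]; last exact: span_tensor_mul Gg.
rewrite (_ : 1 = tensor_basis [ffun=> inl (inl (0, 0)%N)]); first exact: span_gen.
by rewrite /tensor_basis big1 // => i _; rewrite ffunE /= mulr1.
Qed.

Lemma alg_I_tensor_basis w : alg_I (tensor_basis w).
Proof.
apply: (big_ind (@alg_I K n)) => [|f g|i _].
- exact: gen_subalg1.
- exact: gen_subalgM.
- exact/alg_I1_sub/alg_I1_basis.
Qed.

Lemma tensor_basisP : is_basis (@alg_I K n) tensor_basis.
Proof.
split; [exact: alg_I_tensor_basis|exact: basis_prod_indep|].
by move=> f /alg_I_span/span_sum.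
Qed.

Lemma I1_basisP i : is_basis (alg_I1 i) (I1_basis K i).
Proof.
split; first exact: alg_I1_basis.
- move=> s c s_uniq sum0 j js.
  have single_inj : injective (single i).
    by move=> j1 j2 /ffunP/(_ i); rewrite !ffunE eqxx.
  have := @basis_prod_indep (map (single i) s) (fun w => c (w i)).
  rewrite map_inj_uniq // big_map => /(_ s_uniq) /(_ _ (single i j)).
  rewrite ffunE eqxx map_f //; apply => //; rewrite -[RHS]sum0.
  by apply: eq_bigr => k _; rewrite basis_single ffunE eqxx.
- move=> f If; apply: span_sum; have := gen_subalg_normal_form (d_int i) (d_x i) (int_d_x i) If.
  by apply: span_trans => j; rewrite -I1_basisE; apply: span_gen.
Qed.

End Action.

Lemma basis_direct_sum (K : fieldType) (V : lmodType K) (J : eqType)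
    (Q : V -> Prop) (b : J -> V) :
  (forall c v, Q v -> Q (c *: v)) -> is_basis Q b ->
  is_direct_sum Q (fun j => line (b j)).
Proof.
move=> QZ [Qb b_indep b_span]; split.
- by move=> j _ [c ->]; apply: QZ.
- move=> s w s_uniq /choice[c wE] sum0 j js.
  rewrite wE (b_indep s c s_uniq) ?scale0r // -[RHS]sum0.
  by apply: eq_bigr => k _; rewrite wE.
- move=> v /b_span[s [c ->]]; exists s, (fun j => c j *: b j); split=> // j.
  by exists (c j).
Qed.

Theorem mainTheorem4 (K : fieldType) (charK : [pchar K] =i pred0) :
  (is_direct_sum (@alg_I K 1)
     (fun j : I1_index => line (I1_basis K (ord0 : 'I_1) j))
   /\ is_basis (@alg_I K 1) (I1_basis K (ord0 : 'I_1)))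
  /\
  forall n : nat, (0 < n)%N ->
    (forall i : 'I_n, is_basis (alg_I1 i) (I1_basis K i))
    /\ is_basis (@alg_I K n)
         (fun w : {ffun 'I_n -> I1_index} => \prod_(i < n) I1_basis K i (w i)).
Proof.
have basis1 : is_basis (@alg_I K 1) (I1_basis K (ord0 : 'I_1)).
  have [Ib b_indep b_span] := I1_basisP charK (ord0 : 'I_1); split=> //.
    by move=> j; apply/alg_I1_sub/Ib.
  move=> f If; apply/b_span/gen_subalg_sub/If => g [i].
  by rewrite [i]ord1.
split; last by move=> n _; split; [exact: I1_basisP|exact: tensor_basisP].
split=> //; apply: basis_direct_sum basis1 => c f.
exact: gen_subalgZ.
Qed.
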